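(* Let $p$ be any prime with $p\equiv 3\pmod 4$ and let $n\geq 1$. For all $\mathbf{v},\mathbf{w}\in\mathbb{F}_{p^2}^n$, $$N(\mathbf{v}\cdot\mathbf{w})\leq N(\mathbf{v})\,N(\mathbf{w}),$$ where $N$ denotes the Manhattan norm (on $\mathbb{F}_{p^2}$ on the left-hand side, on $\mathbb{F}_{p^2}^n$ on the right-hand side).
   Context: For a prime $p\equiv 3\pmod 4$, the field $\mathbb{F}_{p^2}$ is regarded as $\mathbb{Z}[i]/(p)$. Manhattan norm: $\mathbb{F}_{p^2}$ is a graph in which two distinct vertices $u,z$ are adjacent if $(z-u)^4=1$ (equivalently $z-u\in\{1,-1,i,-i\}$). For $z\in\mathbb{F}_{p^2}$, $N(z)$ is the graph distance from $0$ to $z$ in this graph. The vector space $\mathbb{F}_{p^2}^n$ carries the Cartesian product graph structure, and the Manhattan norm of $\mathbf{v}=(v_1,\ldots,v_n)\in\mathbb{F}_{p^2}^n$ is its distance from the null vector, which equals $N(\mathbf{v})=N(v_1)+\cdots+N(v_n)$. Inner product: for $z\in\mathbb{F}_{p^2}$, $\overline{z}$ is the image of $z$ under the only non-trivial automorphism of $\mathbb{F}_{p^2}$. For $\mathbf{v}=(v_1,\ldots,v_n)$ and $\mathbf{w}=(w_1,\ldots,w_n)$ in $\mathbb{F}_{p^2}^n$, $\mathbf{v}\cdot\mathbf{w}=v_1\overline{w_1}+\cdots+v_n\overline{w_n}\in\mathbb{F}_{p^2}$. *)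

(* Defs.v *)
From mathcomp Require Import all_boot all_order all_algebra.

Set Implicit Arguments.
Unset Strict Implicit.
Unset Printing Implicit Defensive.

Import GRing.Theory.
Local Open Scope ring_scope.

Definition walk (T : finType) (e : rel T) (x y : T) (k : nat) : bool :=
  [exists t : k.-tuple T, path e x t && (last x t == y)].

(* A shortest walk visits each vertex at most once, so it has fewer than #|T|
   edges and the search below is exhaustive. The value is #|T| exactly when y
   is not reachable from x, which does not happen in the connected graphs to
   which this is applied. *)
Definition gdist (T : finType) (e : rel T) (x y : T) : nat :=
  find (walk e x y) (iota 0 #|T|).

Definition cart_pow (T : finType) (e : rel T) (n : nat) : rel 'rV[T]_n :=
  fun u z => [exists i, e (u 0 i) (z 0 i) &&
                [forall j, (j != i) ==> (u 0 j == z 0 j)]].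

(* For #|F| = p ^ 2 with p = 3 mod 4, F is isomorphic to Z[i]/(p) and the fourth
   roots of unity are 1, -1, i and -i; the relation does not depend on the
   choice of i. *)
Definition gauss_adj (F : finFieldType) : rel F :=
  fun u z => (u != z) && ((z - u) ^+ 4 == 1).

Definition manhattan (F : finFieldType) (z : F) : nat :=
  gdist (@gauss_adj F) 0 z.

Definition manhattan_vec (F : finFieldType) (n : nat) (v : 'rV[F]_n) : nat :=
  gdist (@cart_pow F (@gauss_adj F) n) 0 v.

(* conj is meant to be the only non-trivial automorphism of F. *)
Definition herm_dot (F : finFieldType) (conj : F -> F) (n : nat)
    (v w : 'rV[F]_n) : F :=
  \sum_(i < n) v 0 i * conj (w 0 i).

(* Main.v *)
Require Import Defs.
From mathcomp Require Import all_boot all_order all_algebra.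

Set Implicit Arguments.
Unset Strict Implicit.
Unset Printing Implicit Defensive.

Import GRing.Theory.
Local Open Scope ring_scope.

(** The norms are word lengths for the fourth roots of unity and for their
    multiples of the standard basis vectors. Expand [v] and [w] as shortest sums
    of such steps: since the fourth roots of unity are closed under products and
    under [conj], the inner product of two steps is zero or again a fourth root
    of unity, so [herm_dot conj v w] is a sum of at most
    [manhattan_vec v * manhattan_vec w] of them.

    The sums are never written down. A function on vertices that grows by at
    most [c] along each edge grows by at most [c] times the length along a walk
    ([gdist_lipschitz]); applied three times, this bounds [manhattan] of a sum
    ([manhattanD]), of a unit times a conjugated coordinate
    ([manhattan_unit_coord]), and of the inner product as a function of its
    first argument.

    When [gdist] takes its default value [#|T|] there is no walk to follow.
    Every distance in [F] is at most [#|F|], and a vector of positive dimension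
    with the default norm has norm at least [#|F|], so the bounds hold in that
    case by size alone. *)

Section GraphDistance.

Variables (T : finType) (e : rel T).
Implicit Types (x y z : T) (k c : nat) (f : T -> nat).

Lemma gdist_le_card x y : (gdist e x y <= #|T|)%N.
Proof. by rewrite -[leqRHS](size_iota 0) find_size. Qed.

Lemma gdist_le_walk x y k : walk e x y k -> (gdist e x y <= k)%N.
Proof.
move=> xyk; have [Tk|kT] := leqP #|T| k.
  exact: leq_trans (gdist_le_card x y) Tk.
rewrite leqNgt; apply/negP => /(before_find 0%N).
by rewrite nth_iota // add0n xyk.
Qed.

Lemma walk_gdist x y : (gdist e x y < #|T|)%N -> walk e x y (gdist e x y).
Proof.
move=> ltT; have := ltT; rewrite -[ltnRHS](size_iota 0) -has_find.
by move=> /(nth_find 0%N); rewrite nth_iota.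
Qed.

Lemma walk0 x : walk e x x 0.
Proof. by apply/existsP; exists [tuple]; rewrite /= eqxx. Qed.

Lemma walk_rcons x y z k : walk e x y k -> e y z -> walk e x z k.+1.
Proof.
move=> /existsP[t /andP[et /eqP <-]] eyz; apply/existsP.
by exists [tuple of rcons t z]; rewrite /= rcons_path last_rcons et eyz eqxx.
Qed.

Lemma gdist_refl x : gdist e x x = 0%N.
Proof. by apply/eqP; rewrite -leqn0 gdist_le_walk ?walk0. Qed.

Lemma gdist_edge x y z : e y z -> (gdist e x z <= (gdist e x y).+1)%N.
Proof.
move=> eyz; have [Txy|xyT] := leqP #|T| (gdist e x y).
  by apply: leq_trans (gdist_le_card x z) _; apply: leqW.
exact: gdist_le_walk (walk_rcons (walk_gdist xyT) eyz).
Qed.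

(** Replaces explicit decompositions into steps: a bound on the change along one
    edge is all that has to be checked, and it is multiplied by the length. *)
Lemma walk_lipschitz f c x y k :
    (forall a b, e a b -> (f b <= f a + c)%N) ->
  walk e x y k -> (f y <= f x + k * c)%N.
Proof.
move=> fP /existsP[[t /= /eqP <-] /andP[et /eqP <-]] {y k}.
elim: t x et => [|z t IHt] x /=; first by rewrite addn0.
move=> /andP[exz et]; apply: leq_trans (IHt z et) _.
by rewrite mulSn addnA leq_add2r fP.
Qed.

Lemma gdist_lipschitz f c x y :
    (forall a b, e a b -> (f b <= f a + c)%N) ->
  (gdist e x y < #|T|)%N -> (f y <= f x + gdist e x y * c)%N.
Proof. by move=> fP /walk_gdist; apply: walk_lipschitz. Qed.

Lemma gdist_eq0 x y : gdist e x y = 0%N -> x = y.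
Proof.
move=> d0; have: walk e x y 0.
  by rewrite -d0 walk_gdist // d0; apply/card_gt0P; exists x.
by move=> /existsP[t]; rewrite tuple0 /= => /eqP.
Qed.

End GraphDistance.

Section ManhattanNorm.

Variable F : finFieldType.
Implicit Types (a u z : F).

Lemma manhattan_addunit z a :
  a ^+ 4 = 1 -> (manhattan (z + a)%R <= (manhattan z).+1)%N.
Proof.
move=> a4; apply: gdist_edge; rewrite /gauss_adj [z + a - z]addrC addKr a4 eqxx andbT.
apply/eqP => za; move: a4; rewrite (_ : a = 0) ?expr0n.
  by move/eqP; rewrite eq_sym oner_eq0.
by rewrite -[a](addKr z) -za addNr.
Qed.

Lemma manhattanD (y z : F) : (manhattan (y + z)%R <= manhattan y + manhattan z)%N.
Proof.
have [Fz|zF] := leqP #|F| (manhattan z).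
  exact/(leq_trans (gdist_le_card _ _ _))/(leq_trans Fz)/leq_addl.
have step a b : gauss_adj a b -> (manhattan (y + b)%R <= manhattan (y + a)%R + 1)%N.
  move=> /andP[_ /eqP ab4].
  by rewrite addn1 -[b](subrK a) [b - a + a]addrC addrA manhattan_addunit.
by have := gdist_lipschitz step zF; rewrite addr0 muln1.
Qed.

Lemma card_le_manhattan_vec n (v : 'rV[F]_n) :
  (0 < n)%N -> (#|{: 'rV[F]_n}| <= manhattan_vec v)%N ->
  (#|F| <= manhattan_vec v)%N.
Proof.
move=> n_gt0; apply: leq_trans; rewrite card_mx mul1n -{1}[#|F|]expn1.
by rewrite leq_pexp2l //; apply/card_gt0P; exists 0.
Qed.

Variable conj : {rmorphism F -> F}.

(** Walk from the zero vector to [w]: an edge changes one coordinate by a fourth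
    root of unity [a], so [u * conj (w 0 i)] is unchanged or changes by the
    fourth root of unity [u * conj a]. *)
Lemma manhattan_unit_coord n (w : 'rV[F]_n) i u :
  u ^+ 4 = 1 -> (manhattan (u * conj (w 0 i))%R <= manhattan_vec w)%N.
Proof.
move=> u4; have n_gt0 : (0 < n)%N by case: i => i; apply: leq_ltn_trans.
have [Tw|wT] := leqP #|{: 'rV[F]_n}| (manhattan_vec w).
  exact: leq_trans (gdist_le_card _ _ _) (card_le_manhattan_vec n_gt0 Tw).
pose f (x : 'rV[F]_n) := manhattan (u * conj (x 0 i)).
have step x y : cart_pow (@gauss_adj F) x y -> (f y <= f x + 1)%N.
  rewrite /f => /existsP[j /andP[/andP[_ /eqP xy4] /forallP xy]].
  have [->|ij] := eqVneq i j; last first.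
    by have /implyP/(_ ij)/eqP -> := xy i; apply: leq_addr.
  rewrite -[y 0 j](subrK (x 0 j)) addrC rmorphD mulrDr addn1.
  by apply: manhattan_addunit; rewrite exprMn u4 mul1r -rmorphXn xy4 rmorph1.
have := gdist_lipschitz step wT.
by rewrite /f mxE rmorph0 mulr0 [manhattan 0]gdist_refl muln1.
Qed.

Lemma herm_dot0l n (w : 'rV[F]_n) : herm_dot conj 0 w = 0.
Proof. by apply: big1 => i _; rewrite mxE mul0r. Qed.

Lemma herm_dot0r n (v : 'rV[F]_n) : herm_dot conj v 0 = 0.
Proof. by apply: big1 => i _; rewrite mxE rmorph0 mulr0. Qed.

Lemma herm_dot_change1 n (x y w : 'rV[F]_n) i :
    (forall j, j != i -> x 0 j = y 0 j) ->
  herm_dot conj y w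
    = herm_dot conj x w + (y 0 i - x 0 i) * conj (w 0 i).
Proof.
move=> xy; rewrite /herm_dot (bigD1 i) //= [in RHS](bigD1 i) //=.
rewrite addrAC -mulrDl [_ + (_ - _)]addrC subrK; congr (_ + _).
by apply: eq_bigr => j /xy ->.
Qed.

Lemma manhattan_herm_dot_edge n (w x y : 'rV[F]_n) :
    cart_pow (@gauss_adj F) x y ->
  (manhattan (herm_dot conj y w)
     <= manhattan (herm_dot conj x w) + manhattan_vec w)%N.
Proof.
move=> /existsP[i /andP[/andP[_ /eqP xy4] /forallP xy]].
have eq_xy j : j != i -> x 0 j = y 0 j by have /implyP H := xy j => /H/eqP.
rewrite (herm_dot_change1 w eq_xy); apply: leq_trans (manhattanD _ _) _.
by rewrite leq_add2l manhattan_unit_coord.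
Qed.

End ManhattanNorm.

Theorem mainTheorem6 (p : nat) (p_prime : prime p) (p_mod4 : p = 3 %[mod 4])
    (F : finFieldType) (cardF : #|F| = (p ^ 2)%N)
    (conj : {rmorphism F -> F}) (conj_bij : bijective conj)
    (conj_nontrivial : ~ (conj =1 id))
    (n : nat) (n_ge1 : (1 <= n)%N) (v w : 'rV[F]_n) :
  (manhattan (herm_dot conj v w) <= manhattan_vec v * manhattan_vec w)%N.
Proof.
have [Tv|vT] := leqP #|{: 'rV[F]_n}| (manhattan_vec v); last first.
  have := gdist_lipschitz (@manhattan_herm_dot_edge F conj n w) vT.
  by rewrite herm_dot0l [manhattan 0]gdist_refl.
(* An unreachable [v] makes the bound at least [#|F|], unless [w] is zero. *)
have [w0|w_gt0] := posnP (manhattan_vec w).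
  by rewrite -(gdist_eq0 w0) herm_dot0r [manhattan 0]gdist_refl.
apply: leq_trans (gdist_le_card _ _ _) _.
exact: leq_trans (card_le_manhattan_vec n_ge1 Tv) (leq_pmulr _ w_gt0).
Qed.
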